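(* Let $a<b$ be real numbers and let $f:[a,b]\to\mathbb{R}$ be an absolutely continuous function such that $f'\in L_1(a,b)$ and there exist real numbers $\gamma_1,\Gamma_1$ such that $\gamma_1\le f'(t)\le\Gamma_1$ for $t\in[a,b]$. Let $S=(f(b)-f(a))/(b-a)$. Then $$|Q(f;a,b)|\le\frac{\Gamma_1-\gamma_1}{32}(5-2\sqrt2)(b-a)^2,$$ $$|Q(f;a,b)|\le\left(\frac12-\frac{\sqrt2}{8}\right)(S-\gamma_1)(b-a)^2,$$ $$|Q(f;a,b)|\le\left(\frac12-\frac{\sqrt2}{8}\right)(\Gamma_1-S)(b-a)^2.$$
   Context: For $f$ on $[a,b]$, $$Q(f;a,b)=\int_a^b f(t)\,dt-\left[\frac{\sqrt2}{8}f(a)+\left(1-\frac{\sqrt2}{4}\right)f\left(\frac{a+b}{2}\right)+\frac{\sqrt2}{8}f(b)\right](b-a).$$ The derivative $f'$ of the absolutely continuous function $f$ exists almost everywhere, and the bounds $\gamma_1\le f'(t)\le\Gamma_1$ are understood for almost every $t$. *)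

(* Defs.v *)
From mathcomp Require Import all_boot all_order all_algebra.
From mathcomp Require Import all_classical all_reals all_analysis.
Import Order.TTheory GRing.Theory Num.Theory.
Import numFieldNormedType.Exports.

Set Implicit Arguments.
Unset Strict Implicit.
Unset Printing Implicit Defensive.

Local Open Scope ring_scope.
Local Open Scope classical_set_scope.

(* A function on [a, b] is represented by a total function on R; only its
   values on [a, b] are used.  The intervals may share endpoints or be empty
   (u i = v i, contributing 0). *)
Definition absolutely_continuous (R : realType) (a b : R) (f : R -> R) : Prop :=
  forall e : R, 0 < e -> exists2 d : R, 0 < d &
    forall (n : nat) (u v : 'I_n -> R),
      (forall i, [/\ a <= u i, u i <= v i & v i <= b]) ->
      trivIset [set: 'I_n] (fun i => `]u i, v i[) ->
      \sum_(i < n) (v i - u i) < d ->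
      \sum_(i < n) `|f (v i) - f (u i)| < e.

Definition quadQ (R : realType) (f : R -> R) (a b : R) : R :=
  (\int[@lebesgue_measure R]_(t in `[a, b]) f t)
  - (Num.sqrt 2 / 8 * f a
     + (1 - Num.sqrt 2 / 4) * f ((a + b) / 2)
     + Num.sqrt 2 / 8 * f b) * (b - a).

(* Main.v *)
Require Import Defs.
From HB Require Import structures.
From mathcomp Require Import all_boot all_order all_algebra.
From mathcomp Require Import all_classical all_reals all_analysis.
From mathcomp Require Import measurable_realfun ring lra.
Import Order.TTheory GRing.Theory Num.Theory.
Import numFieldNormedType.Exports.

Set Implicit Arguments.
Unset Strict Implicit.
Unset Printing Implicit Defensive.

Local Open Scope ring_scope.
Local Open Scope classical_set_scope.

(** Write L = b - a, d = (a + b) / 2 and w = sqrt 2 / 8 * L.  The weights of the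
    rule are, up to the factor L, the lengths of pieces of [a, b]: w for each
    endpoint and L - 2 w for the midpoint.  So the error is the integral of
    f t - f a over [a, a + w], of f t - f d over [a + w, b - w], and of
    f t - f b over [b - w, b].  All three estimates use the derivative only
    through the two-sided slope bound

      gamma1 * (y - x) <= f y - f x <= Gamma1 * (y - x)   (a <= x <= y <= b).

    Given it, f lies below and above explicit affine functions, whose integrals
    are elementary.  Comparing f on each piece with the value at the node that
    the piece belongs to gives the first estimate ([quadQ_le_range]); comparing
    f on each half of [a, b] with the affine functions through one end of that
    half gives the other two ([quadQ_le_slope]).  Upper bounds suffice, because
    passing to - f exchanges the roles of the two slopes and changes the sign of
    the error.

    The real work is the slope bound ([ac_slope_bounds]).  The value [f^`() t]
    carries no information at a point where f is not derivable, so it has to be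
    shown that an absolutely continuous function is almost everywhere derivable
    and is the integral of its derivative.  The argument goes through measures:
    the total variation of f over finitely many disjoint short intervals is
    small ([ac_total_variation]), so f = V - (V - f), where V x is the variation
    of f on [a, x], is a difference of two nondecreasing absolutely continuous
    functions.  The Stieltjes measure of such a function vanishes on Lebesgue
    null sets ([ac_cumulative_dominated]), so the Radon-Nikodym theorem gives it
    a density ([ac_nondecreasing_density]).  Hence f is an indefinite integral of
    some h ([ac_density]), and Lebesgue differentiation identifies h with the
    derivative almost everywhere ([ae_derive_density]). *)

(** * Total variation of an absolutely continuous function *)

Section absolute_continuity.
Variable R : realType.
Implicit Types (a b e : R) (f : R -> R).
Notation TV := total_variation.

(** Families indexed by any finite type are what subdividing each interval of a
    given family produces. *)
Lemma ac_finType a b f : absolutely_continuous a b f -> forall e, 0 < e ->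
  exists2 d : R, 0 < d & forall (I : finType) (u v : I -> R),
      (forall i, [/\ a <= u i, u i <= v i & v i <= b]) ->
      trivIset [set: I] (fun i => `]u i, v i[) ->
      \sum_i (v i - u i) < d -> \sum_i `|f (v i) - f (u i)| < e.
Proof.
move=> fac e /fac[d d0 H]; exists d => // I u v uv tuv.
rewrite !(reindex _ (onW_bij _ (@enum_val_bij I))) /=.
apply: H => //.
  by move=> i j _ _ /(tuv _ _ Logic.I Logic.I)/enum_val_inj.
Qed.

Lemma itv_partition_nth_mono a b s : itv_partition a b s ->
  {homo (fun k => nth b (a :: s) k) : k l / (k <= l)%N >-> k <= l}.
Proof.
move=> abs k l kl.
have [ls|sl] := ltnP l (size s).+1; last first.
  rewrite [leRHS]nth_default //.
  have [ks|sk] := ltnP k (size s).+1; last by rewrite nth_default.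
  exact: itv_partition_nth_le.
case: abs => + _ => /(sub_path (@ltW _ _))/(@sorted_leq_nth _ _ le_trans lexx b (a :: s)).
by apply; rewrite ?inE //= (leq_ltn_trans kl).
Qed.

(** The subintervals cut out by the partitions again form a disjoint family with
    the same total length. *)
Lemma ac_sum_variation a b f : absolutely_continuous a b f -> forall e, 0 < e ->
  exists2 d : R, 0 < d & forall (I : finType) (u v : I -> R) (s : I -> seq R),
      (forall i, [/\ a <= u i, u i <= v i & v i <= b]) ->
      trivIset [set: I] (fun i => `]u i, v i[) ->
      (forall i, itv_partition (u i) (v i) (s i)) ->
      \sum_i (v i - u i) < d -> \sum_i variation (u i) (v i) f (s i) < e.
Proof.
move=> fac e /(ac_finType fac)[d d0 H]; exists d => // I u v s uv tuv suv sd.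
pose N := (\max_i size (s i))%N.
have sN i : (size (s i) <= N)%N by exact: leq_bigmax.
pose P i k := nth (v i) (u i :: s i) k.
have P0 i : P i 0%N = u i by [].
have PN i k : (size (s i) <= k)%N -> P i k = v i.
  move=> sk; apply/eqP; rewrite eq_le; apply/andP; split.
    have [ks|ks] := ltnP k (size (s i)).+1; first exact: itv_partition_nth_le.
    by rewrite /P nth_default.
  rewrite -[leLHS](itv_partition_nth_size (v i) (suv i)).
  exact: (itv_partition_nth_mono (suv i)).
have mP i := itv_partition_nth_mono (suv i).
have Puv i k : u i <= P i k <= v i.
  by rewrite -{1}(P0 i) mP //= -(PN i (maxn k (size (s i)))) ?mP ?leq_maxl ?leq_maxr.
(* Reading a partition past its end returns the right endpoint, so padding all
   partitions to the length N only adds empty intervals. *)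
have := H (I * 'I_N)%type (fun p => P p.1 p.2) (fun p => P p.1 p.2.+1).
rewrite -!(pair_bigA _ (fun i (k : 'I_N) => P i k.+1 - P i k)) /=.
rewrite -!(pair_bigA _ (fun i (k : 'I_N) => `|f (P i k.+1) - f (P i k)|)) /=.
move=> Hs; apply: le_lt_trans (Hs _ _ _).
- apply: ler_sum => i _; rewrite /variation.
  rewrite -(big_mkord predT (fun k => `|f (P i k.+1) - f (P i k)|)).
  by rewrite [leRHS](big_cat_nat _ (sN i)) //= lerDl sumr_ge0.
- move=> [i k] /=; have [au _ vb] := uv i.
  have /andP[uP _] := Puv i k; have /andP[_ Pv] := Puv i k.+1.
  by split; [exact: le_trans uP|exact: mP|exact: le_trans vb].
- move=> [i k] [j l] _ _ /= [x []] /=; rewrite !in_itv /= => /andP[x1 x2] /andP[x3 x4].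
  have ij : i = j.
    apply: tuv => //; exists x; split; rewrite /= in_itv /=; apply/andP; split.
    + by apply: le_lt_trans x1; case/andP: (Puv i k).
    + by apply: lt_le_trans x2 _; case/andP: (Puv i k.+1).
    + by apply: le_lt_trans x3; case/andP: (Puv j l).
    + by apply: lt_le_trans x4 _; case/andP: (Puv j l.+1).
  subst j; congr pair; apply/val_inj/eqP; rewrite eqn_leq /=.
  apply/andP; split; rewrite leqNgt; apply/negP => kl.
    by have := lt_trans x1 x4; rewrite ltNge mP.
  by have := lt_trans x3 x2; rewrite ltNge mP.
- apply: le_lt_trans sd; apply: ler_sum => i _.
  rewrite -(big_mkord predT (fun k => P i k.+1 - P i k)) telescope_sumr // P0 lerD2r.
  by case/andP: (Puv i N).
Qed.

(** Taking suprema over the partitions in [ac_sum_variation].  The variations are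
    first shown to be finite, since [fine] would send an infinite one to 0. *)
Lemma ac_total_variation a b f : absolutely_continuous a b f ->
  forall e, 0 < e ->
  exists2 d : R, 0 < d & forall (I : finType) (u v : I -> R),
      (forall i, [/\ a <= u i, u i <= v i & v i <= b]) ->
      trivIset [set: I] (fun i => `]u i, v i[) ->
      \sum_i (v i - u i) < d ->
      (forall i, TV (u i) (v i) f \is a fin_num) /\
      \sum_i fine (TV (u i) (v i) f) <= e.
Proof.
move=> fac e /(ac_sum_variation fac)[d d0 H]; exists d => // I u v uv tuv sd.
have finTV i : TV (u i) (v i) f \is a fin_num.
  have [aui uvi vib] := uv i.
  rewrite ge0_fin_numE ?total_variation_ge0 // (@le_lt_trans _ _ e%:E) ?ltry //.
  apply: ge_ereal_sup => _ [_ [s suv <-] <-]; rewrite lee_fin ltW //.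
  have := H 'I_1 (fun _ => u i) (fun _ => v i) (fun _ => s).
  rewrite !big_ord1; apply => //; first by move=> k l _ _ _; rewrite !ord1.
  apply: le_lt_trans sd; rewrite (bigD1 i) //= lerDl sumr_ge0 // => j _.
  by rewrite subr_ge0; case: (uv j).
split => //; apply/ler_addgt0Pr => h h0.
pose n := #|I|.+1%:R : R.
have hn : 0 < h / n by rewrite divr_gt0 // ltr0n.
have /choice[s sP] : forall i, exists s : seq R, itv_partition (u i) (v i) s /\
    fine (TV (u i) (v i) f) <= variation (u i) (v i) f s + h / n.
  move=> i; have [_ [_ [s sp <-] <-] hs] := ub_ereal_sup_adherent hn (finTV i).
  exists s; split => //; rewrite -lerBlDr ltW // -lte_fin.
  by rewrite EFinB fineK // -/(TV _ _ _) ?finTV.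
apply: (@le_trans _ _ (\sum_i (variation (u i) (v i) f (s i) + h / n))).
  by apply: ler_sum => i _; case: (sP i).
rewrite big_split /= lerD //.
  by apply/ltW/H => // i; case: (sP i).
rewrite sumr_const -mulr_natr mulrAC ler_pdivrMr ?ltr0n // ler_pM2l //.
by rewrite ler_nat.
Qed.

(** Short intervals have finite variation, and variation is additive, so it
    remains finite after finitely many steps of length d / 2. *)
Lemma ac_total_variation_fin a b f : absolutely_continuous a b f ->
  forall x y, a <= x -> x <= y -> y <= b -> TV x y f \is a fin_num.
Proof.
move=> fac x y ax xy yb.
have [d d0 H] := ac_total_variation fac ltr01.
have small u v : a <= u -> u <= v -> v <= b -> v - u < d ->
    TV u v f \is a fin_num.
  move=> au uv vb uvd.
  have [] := H 'I_1 (fun _ => u) (fun _ => v) => //.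
  - by move=> k l _ _ _; rewrite !ord1.
  - by rewrite big_ord1.
  - by move=> /(_ ord0).
have [n] : exists n : nat, y <= x + n%:R * (d / 2).
  exists (Num.bound ((y - x) / (d / 2))).
  rewrite -lerBlDl -ler_pdivrMr ?divr_gt0 // ltW //.
  by apply: archi_boundP; rewrite divr_ge0 ?subr_ge0 // divr_ge0 // ltW.
elim: n y xy yb => [|n IH] y xy yb.
  rewrite mul0r addr0 => yx.
  by have -> : y = x by [apply/le_anti/andP]; rewrite total_variationxx.
rewrite -natr1 mulrDl mul1r addrA => yn.
have [yd|dy] := lerP (y - d / 2) x.
  by apply: small => //; lra.
rewrite (@total_variationD _ x y (y - d / 2)) ?ltW //; last by lra.
by rewrite fin_numD IH ?small //; lra.
Qed.

Lemma fine_total_variationB a b f x y : absolutely_continuous a b f ->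
  a <= x -> x <= y -> y <= b ->
  fine (TV a y f) - fine (TV a x f) = fine (TV x y f).
Proof.
move=> fac ax xy yb; have fin := ac_total_variation_fin fac.
rewrite (total_variationD f ax xy) fineD ?fin //; last exact: le_trans xy yb.
by rewrite addrAC subrr add0r.
Qed.

Lemma norm_le_fine_total_variation a b f x y : absolutely_continuous a b f ->
  a <= x -> x <= y -> y <= b -> `|f y - f x| <= fine (TV x y f).
Proof.
move=> fac ax xy yb.
rewrite -lee_fin fineK ?total_variation_ge //.
exact: (ac_total_variation_fin fac).
Qed.

(** Applied below to the variation of f and to the difference between that
    variation and f; the factor 2 is for the latter. *)
Lemma ac_dominated a b f g : absolutely_continuous a b f ->
  (forall x y, a <= x -> x <= y -> y <= b ->
    `|g y - g x| <= 2 * fine (TV x y f)) ->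
  absolutely_continuous a b g.
Proof.
move=> fac gf e e0; have e4 : 0 < e / 4 by rewrite divr_gt0.
have [d d0 H] := ac_total_variation fac e4.
exists d => // n u v uv tuv sd; have [_ sTV] := H _ u v uv tuv sd.
apply: (@le_lt_trans _ _ (2 * (e / 4))); last by lra.
apply: le_trans (ler_wpM2l _ sTV) => //.
by rewrite mulr_sumr ler_sum // => i _; have [] := uv i; exact: gf.
Qed.

End absolute_continuity.

(** * Stieltjes measures of absolutely continuous functions *)

Section stieltjes.
Variable R : realType.
Notation mu := (@lebesgue_measure R).

(** Absolute continuity only speaks of disjoint intervals, whereas covers by
    half-open intervals overlap; the ring of sets generated by the half-open
    intervals provides the disjoint form. *)
Lemma bigsetU_ocitv_disjoint n (A : nat -> set R) : (forall k, ocitv (A k)) ->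
  exists m (u v : 'I_m -> R),
    [/\ forall i, u i < v i,
        trivIset [set: 'I_m] (fun i => `]u i, v i]) &
        \big[setU/set0]_(k < n) A k = \big[setU/set0]_(i < m) `]u i, v i]].
Proof.
move=> oA.
have : measurable (\big[setU/set0]_(k < n) A k : set (SetRing.type (ocitv_type R))).
  by apply: bigsetU_measurable => k _; apply: SetRing.measurable_subring; exact: oA.
move=> /SetRing.ring_finite_set[B [/finite_seqP[s ->{B}] s0 sT sm ->]].
pose t := undup s.
have ts X : (X \in t) = (X \in s) by rewrite mem_undup.
have /choice[w wP] : forall i : 'I_(size t), exists w : R * R,
    w.1 < w.2 /\ nth set0 t i = `]w.1, w.2]%classic.
  move=> i; have tis : nth set0 t i \in s by rewrite -ts mem_nth.
  have : ocitv (nth set0 t i) by apply: sm; rewrite inE.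
  by move=> /ocitvP[t0|[w w12 ->]]; [have [] := s0 _ tis; rewrite t0|exists w].
exists (size t), (fun i => (w i).1), (fun i => (w i).2); split.
- by move=> i; case: (wP i).
- have -> : (fun i => `](w i).1, (w i).2]%classic) = (fun i : 'I_(size t) => nth set0 t i).
    by apply/funext => i; case: (wP i).
  move=> i j _ _ /sT ij; apply/val_inj/eqP => /=.
  rewrite -(nth_uniq set0 (ltn_ord i) (ltn_ord j)) ?undup_uniq //.
  by apply/eqP/ij; rewrite /= -ts mem_nth.
- have -> : [set` s] = [set` t] by apply/seteqP; split => X /=; rewrite ts.
  rewrite bigcup_seq (big_nth set0) big_mkord; apply: eq_bigr => i _.
  by case: (wP i).
Qed.

Lemma lebesgue_stieltjes_itvoc (F : cumulative R R) x y : x <= y ->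
  lebesgue_stieltjes_measure F `]x, y]%classic = (F y - F x)%:E.
Proof.
move=> xy; rewrite /lebesgue_stieltjes_measure/= /measure_extension/=.
by rewrite measurable_mu_extE /= ?wlength_itv_bnd //; exists (x, y).
Qed.

(** A null set has a countable cover by half-open intervals of total length below
    d.  Every finite part of the cover is a disjoint union of intervals of total
    length below d, so its Stieltjes measure is at most e, and so is that of the
    whole cover by continuity from below. *)
Lemma ac_cumulative_dominated (F : cumulative R R) :
  (forall e : R, 0 < e -> exists2 d : R, 0 < d &
    forall n (u v : 'I_n -> R), (forall i, u i <= v i) ->
      trivIset [set: 'I_n] (fun i => `]u i, v i[) ->
      \sum_i (v i - u i) < d -> \sum_i (F (v i) - F (u i)) <= e) ->
  lebesgue_stieltjes_measure F `<< mu.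
Proof.
move=> Fac; apply/null_content_dominatesP => N mN N0.
apply/eqP; rewrite eq_le measure_ge0 andbT; apply/lee_addgt0Pr => e e0.
rewrite add0e; have [d d0 H] := Fac e e0.
have /ereal_inf_lt[z [/= A [oA NA] <-] zd] : (mu N < d%:E)%E by rewrite N0 lte_fin.
have mA k : measurable (A k : set (measurableTypeR R)) by apply: sub_sigma_algebra; exact: oA.
pose U n := \big[setU/set0]_(k < n.+1) A k.
have mU n : measurable (U n : set (measurableTypeR R)) by exact: bigsetU_measurable.
have UA : \bigcup_n U n = \bigcup_n A n by rewrite bigcup_bigsetU_bigcup.
have mUA : measurable (\bigcup_n U n : set (measurableTypeR R)) by exact: bigcup_measurable.
apply: (@le_trans _ _ (lebesgue_stieltjes_measure F (\bigcup_n U n))).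
  by apply: le_measure; rewrite ?inE // UA.
have ndU : {homo U : n m / (n <= m)%N >-> (n <= m)%O}.
  by move=> n m nm; rewrite subsetEset; exact: subset_bigsetU.
have cvgU := @nondecreasing_cvg_mu _ _ _ (lebesgue_stieltjes_measure F) U mU mUA ndU.
rewrite -(cvg_lim _ cvgU) //; apply: lime_le; first by apply/cvg_ex; eexists; exact: cvgU.
apply: nearW => n /=.
have [m [u [v [uv tuv Uuv]]]] := bigsetU_ocitv_disjoint n.+1 oA.
have muv i : measurable (`]u i, v i]%classic : set (measurableTypeR R)).
  by apply: sub_sigma_algebra; exact: is_ocitv.
have sumE (G : cumulative R R) :
    (lebesgue_stieltjes_measure G (U n) = (\sum_i (G (v i) - G (u i)))%:E)%E.
  rewrite /U Uuv measure_semi_additive_ord //; last by rewrite -Uuv; exact: mU.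
  by rewrite -sumEFin; apply: eq_bigr => i _; exact/lebesgue_stieltjes_itvoc/ltW.
rewrite sumE lee_fin; apply: H.
- by move=> i; exact/ltW.
- move=> i j _ _ [x [xi xj]]; apply: tuv => //.
  by exists x; split; exact: subset_itv_oo_oc.
- rewrite -lte_fin -(sumE idfun); apply: le_lt_trans zd.
  (* A also covers U n, so it bounds the outer measure of U n. *)
  apply: ereal_inf_lbound; exists A => //; split => //.
  by rewrite -UA; exact: bigcup_sup.
Qed.

Lemma ac_nondecreasing_cumulative a b (G : R -> R) : a <= b ->
  (forall x y, a <= x -> x <= y -> y <= b -> G x <= G y) ->
  absolutely_continuous a b G ->
  exists F : cumulative R R,
    (forall x, a <= x -> x <= b -> F x = G x) /\
    lebesgue_stieltjes_measure F `<< mu.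
Proof.
move=> ab ndG acG.
(* G is extended to a cumulative function on the line by clamping to [a, b];
   clamping shortens intervals and keeps disjoint interiors disjoint. *)
pose c x := Num.min (Num.max x a) b.
have ac x : a <= c x by rewrite /c le_min ab andbT le_max lexx orbT.
have cb x : c x <= b by rewrite /c ge_min lexx orbT.
have cE x : a <= x -> x <= b -> c x = x.
  by move=> ax xb; rewrite /c max_l // min_l.
have cnd x y : x <= y -> c x <= c y.
  move=> xy; rewrite /c; have [?|?] := lerP x a; have [?|?] := lerP y a;
  rewrite ?(min_l ab); have [?|?] := lerP y b; have [?|?] := lerP x b; lra.
have clip x y : x <= y -> c y - c x <= y - x.
  move=> xy; rewrite /c; have [?|?] := lerP x a; have [?|?] := lerP y a;
  rewrite ?(min_l ab); have [?|?] := lerP y b; have [?|?] := lerP x b; lra.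
have Fac e : 0 < e -> exists2 d : R, 0 < d &
    forall n (u v : 'I_n -> R), (forall i, u i <= v i) ->
      trivIset [set: 'I_n] (fun i => `]u i, v i[) ->
      \sum_i (v i - u i) < d -> \sum_i (G (c (v i)) - G (c (u i))) <= e.
  move=> /acG[d d0 H]; exists d => // n u v uv tuv sd.
  apply/ltW/(le_lt_trans _ (H n (c \o u) (c \o v) _ _ _)).
  - by apply: ler_sum => i _; exact: ler_norm.
  - by by move=> i; split => /=; [exact: ac|exact: cnd|exact: cb].
  - move=> i j _ _ [x [/=]]; rewrite !in_itv /= => /andP[ux xv] /andP[ux' xv'].
    have ax : a <= x by rewrite (le_trans (ac (u i))) ?ltW.
    have xb : x <= b by rewrite (le_trans _ (cb (v i))) ?ltW.
    have lec y : c y < x -> y < x.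
      by rewrite !ltNge; apply: contra => /cnd; rewrite cE.
    have gec y : x < c y -> x < y.
      by rewrite !ltNge; apply: contra => /cnd; rewrite (cE x).
    apply: tuv => //; exists x.
    by split; rewrite /= in_itv /=; apply/andP; split; (exact: lec || exact: gec).
  - by apply: le_lt_trans sd; apply: ler_sum => i _; exact: clip.
have F0nd : nondecreasing_fun (G \o c).
  by move=> x y xy /=; apply: ndG => //; exact: cnd.
have F0rc : right_continuous (G \o c).
  move=> x; apply/cvgrPdist_le => e /Fac[d d0 H].
  near=> y.
  have xy : x <= y by near: y; exact: nbhs_right_ge.
  rewrite distrC ger0_norm ?subr_ge0; last exact: F0nd.
  have := H 1%N (fun _ => x) (fun _ => y); rewrite !big_ord1; apply => //.
    by move=> i j _ _ _; rewrite !ord1.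
  by rewrite ltrBlDl; near: y; apply: nbhs_right_lt; rewrite ltrDl.
pose F : cumulative R R := HB.pack (G \o c)
  (isCumulative.Build R _ R (G \o c) F0nd F0rc).
exists F; split; first by move=> x ax xb /=; rewrite cE.
exact: ac_cumulative_dominated.
Unshelve. all: by end_near. Qed.

(** The Radon-Nikodym theorem for the Stieltjes measure of G, restricted to
    `]a, b] to make it finite. *)
Lemma ac_nondecreasing_density a b (G : R -> R) : a <= b ->
  (forall x y, a <= x -> x <= y -> y <= b -> G x <= G y) ->
  absolutely_continuous a b G ->
  exists h : R -> R, mu.-integrable setT (EFin \o h) /\
    forall x y, a <= x -> x <= y -> y <= b ->
      G y - G x = \int[mu]_(t in `]x, y]) h t.
Proof.
move=> ab ndG acG.
have [F [FG Fmu]] := ac_nondecreasing_cumulative ab ndG acG.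
have mab : measurable (`]a, b]%classic : set (measurableTypeR R)) by exact: measurable_itv.
have fin : (lebesgue_stieltjes_measure F `]a, b]%classic < +oo)%E.
  by rewrite lebesgue_stieltjes_itvoc // ltry.
pose nu : {finite_measure set (measurableTypeR R) -> \bar R} := mfrestr mab fin.
have numu : nu `<< mu.
  apply/null_content_dominatesP => S mS S0; rewrite /nu /= /mfrestr /mrestr.
  move/null_content_dominatesP : Fmu; apply; first exact: measurableI.
  by apply/eqP; rewrite eq_le measure_ge0 andbT -S0 measureIl.
have [g [_ gfin gint gE]] := radon_nikodym_sigma_finite numu.
have gEfin : EFin \o (fine \o g) = g by apply/funext => x /=; rewrite fineK.
exists (fine \o g); split; first by rewrite gEfin.
move=> x y ax xy yb.
rewrite /Rintegral -[X in integral _ _ X]/(EFin \o (fine \o g)) gEfin -gE //=.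
rewrite /mfrestr /mrestr setIidl.
  by rewrite lebesgue_stieltjes_itvoc //= !FG // (le_trans ax, le_trans xy).
by apply: subset_itv; rewrite bnd_simp.
Qed.

End stieltjes.

(** * Absolutely continuous functions as indefinite integrals *)

Section density.
Variable R : realType.
Notation mu := (@lebesgue_measure R).

(** f is the difference of its variation V and of V - f, both nondecreasing and
    absolutely continuous. *)
Lemma ac_density a b (f : R -> R) : a <= b -> absolutely_continuous a b f ->
  exists h : R -> R, mu.-integrable setT (EFin \o h) /\
    forall x y, a <= x -> x <= y -> y <= b ->
      f y - f x = \int[mu]_(t in `]x, y]) h t.
Proof.
move=> ab fac.
pose V x := fine (total_variation a x f).
have VB x y : a <= x -> x <= y -> y <= b -> V y - V x = fine (total_variation x y f).
  exact: fine_total_variationB.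
have fTV x y : a <= x -> x <= y -> y <= b -> `|f y - f x| <= fine (total_variation x y f).
  exact: norm_le_fine_total_variation.
have [hV [iV hVE]] : exists h : R -> R, mu.-integrable setT (EFin \o h) /\
    forall x y, a <= x -> x <= y -> y <= b ->
      V y - V x = \int[mu]_(t in `]x, y]) h t.
  apply: ac_nondecreasing_density => // [x y ax xy yb|].
    by rewrite -subr_ge0 VB // (le_trans _ (fTV _ _ _ _ _)).
  apply: (ac_dominated fac) => x y ax xy yb; rewrite VB //.
  have TV0 := le_trans (normr_ge0 _) (fTV x y ax xy yb).
  by rewrite ger0_norm; lra.
have [hW [iW hWE]] : exists h : R -> R, mu.-integrable setT (EFin \o h) /\
    forall x y, a <= x -> x <= y -> y <= b ->
      (V y - f y) - (V x - f x) = \int[mu]_(t in `]x, y]) h t.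
  apply: (@ac_nondecreasing_density _ a b (fun x => V x - f x)) => // [x y ax xy yb|].
    have := fTV x y ax xy yb; rewrite -VB // ler_norml /= => /andP[_ ?]. lra.
  apply: (ac_dominated fac) => x y ax xy yb; have VBxy := VB x y ax xy yb.
  have := fTV x y ax xy yb; rewrite !ler_norml /= => /andP[? ?].
  by apply/andP; split; lra.
exists (hV \- hW); split.
  by rewrite (_ : _ \o _ = (EFin \o hV) \- (EFin \o hW))%E //; exact: integrableB.
move=> x y ax xy yb; rewrite RintegralB ?measurable_itv -?hVE -?hWE //; first lra.
  exact: integrableS iV.
exact: integrableS iW.
Qed.

(** The integrand g - f agrees almost everywhere with its absolute value, whose
    integral is nonnegative. *)
Lemma ae_le_Rintegral (D : set (measurableTypeR R)) (f g : R -> R) :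
  measurable D ->
  mu.-integrable D (EFin \o f) -> mu.-integrable D (EFin \o g) ->
  {ae mu, forall t, D t -> f t <= g t} ->
  \int[mu]_(t in D) f t <= \int[mu]_(t in D) g t.
Proof.
move=> mD intf intg fg; rewrite -subr_ge0 -RintegralB //.
have mgf : measurable_fun D (fun t => g t - f t).
  by apply: measurable_funB; apply/measurable_EFinP; exact: (measurable_int mu).
rewrite [leRHS](_ : _ = \int[mu]_(t in D) `|g t - f t|); first exact: Rintegral_ge0.
congr fine; apply: ae_eq_integral => //.
- exact/measurable_EFinP.
- by apply/measurable_EFinP; exact: measurableT_comp.
- by apply: filterS fg => t fg Dt; rewrite ger0_norm // subr_ge0 fg.
Qed.

(** Lebesgue differentiation.  The set of points where f is not derivable lies in
    the exceptional null set. *)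
Lemma ae_derive_density a b (f h : R -> R) :
  mu.-integrable setT (EFin \o h) ->
  (forall x, a <= x -> x <= b -> f x - f a = \int[mu]_(t in `]a, x]) h t) ->
  {ae mu, forall x, a < x < b -> f^`() x = h x}.
Proof.
move=> ih fh.
have := @FTC1 R h (BRight a) _ _.
have ia y : mu.-integrable [set` Interval (BRight a) (BRight y)] (EFin \o h).
  by apply: integrableS ih => //; exact: measurable_itv.
have lh : locally_integrable [set: R] h.
  by apply: open_integrable_locally => //; exact: openT.
move=> /(_ ia lh) /=; apply: (@filterS _ _ (ae_filter_ringOfSetsType mu)) => x Hx /andP[ax xb].
have [dF <-] := Hx ax; rewrite !derive1E.
set F := fun y => \int[mu]_(t in `]a, y]) h t.
transitivity ('D_1 (cst (f a) + F) x).
  apply: near_eq_derive; near=> y.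
  have ay : a <= y by near: y; exact: (cvgr_ge x).
  have yb : y <= b by near: y; exact: (cvgr_le x).
  by rewrite -[LHS](subrK (f a)) fh // addrC.
rewrite deriveD; [|exact: derivable_cst|exact: dF].
by rewrite derive_cst add0r.
Unshelve. all: by end_near. Qed.

(** The derivative bounds pass to the density, and then to its integral over
    `]x, y[. *)
Lemma ac_slope_bounds a b (f : R -> R) (m M : R) : a <= b ->
  absolutely_continuous a b f ->
  {ae mu, forall t, a <= t <= b -> m <= f^`() t <= M} ->
  forall x y, a <= x -> x <= y -> y <= b ->
    m * (y - x) <= f y - f x <= M * (y - x).
Proof.
move=> ab fac f'mM x y ax xy yb.
have [h [ih fh]] := ac_density ab fac.
have f'h := ae_derive_density ih (fun z az zb => fh a z (lexx a) az zb).
have hmM : {ae mu, forall t, `]x, y[%classic t -> m <= h t <= M}.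
  apply: (@filterS2 _ _ (ae_filter_ringOfSetsType mu) _ _ _ _ f'mM f'h) => t t1 t2; rewrite /= in_itv /= => /andP[xt ty].
  have at_ : a < t by exact: le_lt_trans ax xt.
  have tb : t < b by exact: lt_le_trans ty yb.
  by rewrite -t2 ?at_ ?tb // t1 // !ltW.
have mI : measurable (`]x, y[%classic : set (measurableTypeR R)) by exact: measurable_itv.
have ihI : mu.-integrable `]x, y[ (EFin \o h) by exact: integrableS ih.
have icst (r : R) : mu.-integrable `]x, y[ (EFin \o cst r).
  apply: measurable_bounded_integrable => //; last exact: bounded_cst.
  by rewrite /= lebesgue_measure_itv /=; case: ifP => _; rewrite -?EFinB ltry.
have intcst (r : R) : \int[mu]_(t in `]x, y[) r = r * (y - x).
  rewrite Rintegral_cst //= lebesgue_measure_itv /= lte_fin.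
  by case: ltP => [//|yx]; rewrite (_ : y = x) ?subrr //; apply/le_anti/andP.
rewrite fh // -Rintegral_itv_bndo_bndc //.
apply/andP; split; rewrite -intcst; apply: ae_le_Rintegral => //.
- exact: (icst m).
- by apply: (@filterS _ _ (ae_filter_ringOfSetsType mu) _ _ _ hmM) => t H /H /andP[].
- exact: (icst M).
- by apply: (@filterS _ _ (ae_filter_ringOfSetsType mu) _ _ _ hmM) => t H /H /andP[].
Qed.
End density.

(** * Integrals of functions with bounded slopes *)

Section quadrature.
Variable R : realType.
Notation mu := (@lebesgue_measure R).
Implicit Types (a b c x y m M : R) (f : R -> R).

(** The integrated form of m <= f' <= M. *)
Definition slope_within m M a b f := forall x y,
  a <= x -> x <= y -> y <= b -> m * (y - x) <= f y - f x <= M * (y - x).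

Lemma slope_withinN m M a b f :
  slope_within m M a b f -> slope_within (- M) (- m) a b (fun t => - f t).
Proof.
move=> fmM x y ax xy yb; have /andP[? ?] := fmM x y ax xy yb.
by apply/andP; split; lra.
Qed.

(** The slope bound makes f Lipschitz, hence continuous, on [a, b]. *)
Lemma slope_within_integrable m M a b f : slope_within m M a b f ->
  mu.-integrable `[a, b] (EFin \o f).
Proof.
move=> fmM; apply: continuous_compact_integrable; first exact: segment_compact.
apply/subspace_continuousP => x /=; rewrite in_itv /= => /andP[ax xb].
pose K := `|m| + `|M| + 1.
have K0 : 0 < K by rewrite ltr_wpDl ?addr_ge0.
have lipf u v : a <= u -> u <= v -> v <= b -> `|f v - f u| <= K * (v - u).
  move=> au uv vb; have /andP[f1 f2] := fmM u v au uv vb.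
  have vu0 : 0 <= v - u by rewrite subr_ge0.
  have mK : - K <= m by rewrite lerNl /K; have := ler_norm (- m); rewrite normrN;
    have := normr_ge0 M; lra.
  have MK : M <= K by rewrite /K; have := ler_norm M; have := normr_ge0 m; lra.
  rewrite ler_norml -mulNr (le_trans _ f1) ?ler_wpM2r //=.
  by rewrite (le_trans f2) ?ler_wpM2r.
apply/cvgrPdist_le => e e0; rewrite near_withinE; near=> y.
move=> /=; rewrite in_itv /= => /andP[ay yb].
have xy : `|x - y| <= e / K.
  by near: y; apply: cvgr_dist_le; [exact: cvg_id|rewrite divr_gt0].
have Kxy : K * `|x - y| <= e by rewrite mulrC -ler_pdivlMr.
apply: le_trans Kxy; have [le_xy|/ltW le_yx] := leP x y.
  by rewrite distrC (distrC x) [in leRHS]ger0_norm ?subr_ge0 // lipf.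
by rewrite [in leRHS]ger0_norm ?subr_ge0 // lipf.
Unshelve. all: by end_near. Qed.

(** The base point c of the affine function is free, so that the bounding
    function may be anchored at either end of the interval. *)
Lemma Rintegral_affine x y (k s c : R) : x < y ->
  \int[mu]_(t in `[x, y]) (k + s * (t - c)) =
  k * (y - x) + s / 2 * ((y - c) ^+ 2 - (x - c) ^+ 2).
Proof.
move=> xy.
pose F (t : R) := k * t + s / 2 * (t - c) ^+ 2.
have dF (t : R) : is_derive t 1 F (k + s * (t - c)).
  rewrite /F; apply: is_derive_eq.
  by rewrite /GRing.scale /=; lra.
have cF : continuous F.
  by move=> t; apply: differentiable_continuous; apply/derivable1_diffP; case: (dF t).
rewrite /Rintegral (@continuous_FTC2 _ _ F) //.
- by rewrite /F /=; ring.
- apply: continuous_subspaceT => t.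
  by apply: cvgD; [exact: cvg_cst|apply: cvgMr; apply: cvgB; [exact: cvg_id|exact: cvg_cst]].
- split.
  + by move=> t _; case: (dF t).
  + by apply: cvg_at_right_filter; exact: cF.
  + by apply: cvg_at_left_filter; exact: cF.
- by move=> t _; rewrite derive1E; case: (dF t).
Qed.

Lemma Rintegral_le_affine x y (k s c : R) f : x < y ->
  mu.-integrable `[x, y] (EFin \o f) ->
  (forall t, x <= t -> t <= y -> f t <= k + s * (t - c)) ->
  \int[mu]_(t in `[x, y]) f t <=
  k * (y - x) + s / 2 * ((y - c) ^+ 2 - (x - c) ^+ 2).
Proof.
move=> xy intf fle; rewrite -Rintegral_affine //; apply: le_Rintegral => //.
  apply: continuous_compact_integrable; first exact: segment_compact.
  apply: continuous_subspaceT => t.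
  by apply: cvgD; [exact: cvg_cst|apply: cvgMr; apply: cvgB; [exact: cvg_id|exact: cvg_cst]].
by move=> t /=; rewrite in_itv /= => /andP[? ?]; exact: fle.
Qed.

Lemma Rintegral_itv_split a b c f : a < c -> c < b ->
  mu.-integrable `[a, b] (EFin \o f) ->
  \int[mu]_(t in `[a, b]) f t =
  \int[mu]_(t in `[a, c]) f t + \int[mu]_(t in `[c, b]) f t.
Proof.
move=> ac cb intf; apply/eqP; rewrite addrC -subr_eq Rintegral_itvB //=.
- rewrite Rintegral_itv_obnd_cbnd //; apply: integrableS intf => //.
  by apply: subset_itvr; rewrite bnd_simp ltW.
- by rewrite bnd_simp ltW.
- by rewrite bnd_simp ltW.
Qed.

End quadrature.

(** * The error of the quadrature rule *)

Section midpoint_endpoint_rule.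
Variable R : realType.
Notation mu := (@lebesgue_measure R).
Implicit Types (a b m M : R) (f : R -> R).

Lemma sqrt2_bounds : [/\ 0 <= Num.sqrt 2 :> R, Num.sqrt 2 <= 2 :> R &
  Num.sqrt 2 * Num.sqrt 2 = 2 :> R].
Proof.
have s2 : Num.sqrt 2 * Num.sqrt 2 = 2 :> R by rewrite -expr2 sqr_sqrtr.
have s0 : 0 <= Num.sqrt 2 :> R by exact: sqrtr_ge0.
by split=> //; nra.
Qed.

Lemma quadQN a b f : mu.-integrable `[a, b] (EFin \o f) ->
  quadQ (fun t => - f t) a b = - quadQ f a b.
Proof.
move=> intf; rewrite /quadQ.
have -> : \int[mu]_(t in `[a, b]) - f t = - \int[mu]_(t in `[a, b]) f t.
  rewrite -mulN1r -RintegralZl //.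
  by apply: eq_Rintegral => t _; rewrite mulN1r.
ring.
Qed.

(** The first bound compares f with the line of slope M through the left end, the
    second with the line of slope m through the right end. *)
Lemma Rintegral_le_slope m M a b f x y : slope_within m M a b f ->
  a <= x -> x < y -> y <= b ->
  \int[mu]_(t in `[x, y]) f t <= f x * (y - x) + M / 2 * (y - x) ^+ 2 /\
  \int[mu]_(t in `[x, y]) f t <= f y * (y - x) - m / 2 * (y - x) ^+ 2.
Proof.
move=> fmM ax xy yb.
have intf : mu.-integrable `[x, y] (EFin \o f).
  apply: integrableS (slope_within_integrable fmM) => //.
  by apply: subset_itv; rewrite bnd_simp.
split.
- rewrite [leRHS](_ : _ = f x * (y - x) + M / 2 * ((y - x) ^+ 2 - (x - x) ^+ 2)); last by ring.
  apply: Rintegral_le_affine => // t xt ty.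
  by have /andP[_ +] := fmM x t ax xt (le_trans ty yb); lra.
- rewrite [leRHS](_ : _ = f y * (y - x) + m / 2 * ((y - y) ^+ 2 - (x - y) ^+ 2)); last by ring.
  apply: Rintegral_le_affine => // t xt ty.
  by have /andP[+ _] := fmM t y (le_trans ax xt) ty yb; lra.
Qed.

(** On each of the four pieces between a, a + w, d, b - w and b, the function f is
    compared with the line of extreme slope through the node of the piece (a, d, d
    and b).  The weight of a node is the total length of its pieces, so the nodal
    values cancel, and what remains is
    (M - m) / 2 * (w ^ 2 + (L / 2 - w) ^ 2). *)
Lemma quadQ_le_range m M a b f : a < b -> slope_within m M a b f ->
  quadQ f a b <= (M - m) / 32 * (5 - 2 * Num.sqrt 2) * (b - a) ^+ 2.
Proof.
move=> ab fmM; have [s0 s2 ss] := sqrt2_bounds.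
have intf := slope_within_integrable fmM.
rewrite /quadQ; move: s0 s2 ss; set s := Num.sqrt 2 => s0 s2 ss.
have [L L0 bE] : exists2 L, 0 < L & b = a + L.
  by exists (b - a); rewrite ?subr_gt0 // addrC subrK.
rewrite (_ : (a + b) / 2 = a + L / 2); last by rewrite bE; field.
rewrite (_ : b - a = L); last by rewrite bE; ring.
move: bE fmM intf => -> fmM intf {ab b}.
have [w wE] : exists w, w = s / 8 * L by exists (s / 8 * L).
have s1 : 1 <= s by nra.
have w0 : 0 < w by rewrite wE; nra.
have wL : w < L / 2 by rewrite wE; nra.
have intl : mu.-integrable `[a, a + L / 2] (EFin \o f).
  by apply: integrableS intf => //; apply: subset_itv; rewrite bnd_simp //; lra.
have intr : mu.-integrable `[a + L / 2, a + L] (EFin \o f).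
  by apply: integrableS intf => //; apply: subset_itv; rewrite bnd_simp //; lra.
rewrite (@Rintegral_itv_split _ a (a + L) (a + L / 2)) //; [|lra..].
rewrite (@Rintegral_itv_split _ a (a + L / 2) (a + w)) //; [|lra..].
rewrite (@Rintegral_itv_split _ (a + L / 2) (a + L) (a + L - w)) //; [|lra..].
have [||| + _] := @Rintegral_le_slope _ _ _ _ _ a (a + w) fmM; [lra..|].
have [||| _ +] := @Rintegral_le_slope _ _ _ _ _ (a + w) (a + L / 2) fmM; [lra..|].
have [||| + _] := @Rintegral_le_slope _ _ _ _ _ (a + L / 2) (a + L - w) fmM; [lra..|].
have [||| _ +] := @Rintegral_le_slope _ _ _ _ _ (a + L - w) (a + L) fmM; [lra..|].
rewrite (_ : a + w - a = w); last by ring.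
rewrite (_ : a + L / 2 - (a + w) = L / 2 - w); last by ring.
rewrite (_ : a + L - w - (a + L / 2) = L / 2 - w); last by field.
rewrite (_ : a + L - (a + L - w) = w); last by ring.
move=> I4 I3 I2 I1.
have -> : (M - m) / 32 * (5 - 2 * s) * L ^+ 2 =
    (M - m) / 2 * (w ^+ 2 + (L / 2 - w) ^+ 2).
  have -> : w ^+ 2 + (L / 2 - w) ^+ 2 = (s * s / 32 - s / 8 + 1 / 4) * L ^+ 2.
    by rewrite wE; field.
  by rewrite ss; field.
have -> : (s / 8 * f a + (1 - s / 4) * f (a + L / 2) + s / 8 * f (a + L)) * L =
    f a * w + 2 * (f (a + L / 2) * (L / 2 - w)) + f (a + L) * w.
  by rewrite wE; field.
by lra.
Qed.

(** For the bound with S - m, each half of [a, b] is compared with the line of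
    slope m through its right end; this leaves a multiple of f d, which is
    eliminated with m * (L / 2) <= f d - f a and the nonnegative factor
    1 / 2 - sqrt 2 / 4.  The bound with M - S is symmetric, from the left ends. *)
Lemma quadQ_le_slope m M a b f : a < b -> slope_within m M a b f ->
  let S := (f b - f a) / (b - a) in
  quadQ f a b <= (1 / 2 - Num.sqrt 2 / 8) * (S - m) * (b - a) ^+ 2 /\
  quadQ f a b <= (1 / 2 - Num.sqrt 2 / 8) * (M - S) * (b - a) ^+ 2.
Proof.
move=> ab fmM S; have [s0 s2 _] := sqrt2_bounds.
have intf := slope_within_integrable fmM.
rewrite /quadQ; move: s0 s2; set s := Num.sqrt 2 => s0 s2.
have [L L0 bE] : exists2 L, 0 < L & b = a + L.
  by exists (b - a); rewrite ?subr_gt0 // addrC subrK.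
have SL : S * (b - a) = f b - f a by rewrite divfK // subr_eq0 gt_eqF.
move: SL; rewrite (_ : (a + b) / 2 = a + L / 2); last by rewrite bE; field.
rewrite (_ : b - a = L); last by rewrite bE; ring.
move: bE fmM intf S => -> fmM intf S {ab b} SL.
rewrite (@Rintegral_itv_split _ a (a + L) (a + L / 2)) //; [|lra..].
have [|||I1M I1m] := @Rintegral_le_slope _ _ _ _ _ a (a + L / 2) fmM; [lra..|].
have [|||I2M I2m] := @Rintegral_le_slope _ _ _ _ _ (a + L / 2) (a + L) fmM; [lra..|].
have /andP[fam _] : m * (L / 2) <= f (a + L / 2) - f a <= M * (L / 2).
  by have := fmM a (a + L / 2); rewrite addrAC subrr add0r; apply; lra.
have /andP[_ fbM] : m * (L / 2) <= f (a + L) - f (a + L / 2) <= M * (L / 2).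
  by have := fmM (a + L / 2) (a + L);
    rewrite (_ : a + L - (a + L / 2) = L / 2); [apply; lra|field].
have q0 : 0 <= (1 / 2 - s / 4) * L by rewrite mulr_ge0 ?(ltW L0) //; lra.
move: I1M I1m I2M I2m; rewrite (_ : a + L / 2 - a = L / 2); last by ring.
rewrite (_ : a + L - (a + L / 2) = L / 2); last by field.
move=> I1M I1m I2M I2m; split.
- have -> : (1 / 2 - s / 8) * (S - m) * L ^+ 2 =
      (1 / 2 - s / 8) * (S * L - m * L) * L by ring.
  by rewrite SL; have := ler_wpM2l q0 fam; lra.
- have -> : (1 / 2 - s / 8) * (M - S) * L ^+ 2 =
      (1 / 2 - s / 8) * (M * L - S * L) * L by ring.
  by rewrite SL; have := ler_wpM2l q0 fbM; lra.
Qed.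

End midpoint_endpoint_rule.

Theorem theorem7 (R : realType) (a b : R) (f : R -> R) (gamma1 Gamma1 : R)
    (ab : a < b)
    (f_ac : absolutely_continuous a b f)
    (f'_L1 : (@lebesgue_measure R).-integrable `]a, b[ (EFin \o f^`()))
    (f'_bnd : {ae @lebesgue_measure R, forall t, a <= t <= b ->
                gamma1 <= f^`() t <= Gamma1}) :
  let S := (f b - f a) / (b - a) in
  [/\ `|quadQ f a b|
        <= (Gamma1 - gamma1) / 32 * (5 - 2 * Num.sqrt 2) * (b - a) ^+ 2,
      `|quadQ f a b|
        <= (1 / 2 - Num.sqrt 2 / 8) * (S - gamma1) * (b - a) ^+ 2
    & `|quadQ f a b|
        <= (1 / 2 - Num.sqrt 2 / 8) * (Gamma1 - S) * (b - a) ^+ 2].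
Proof.
move=> S.
have fs : slope_within gamma1 Gamma1 a b f by exact: ac_slope_bounds (ltW ab) f_ac f'_bnd.
(* The upper bounds for - f, whose slopes lie between - Gamma1 and - gamma1, are
   the lower bounds for f. *)
have Nfs := slope_withinN fs.
have QN := quadQN (slope_within_integrable fs).
have := quadQ_le_range ab Nfs; have := quadQ_le_slope ab Nfs.
have := quadQ_le_range ab fs; have := quadQ_le_slope ab fs.
rewrite QN !opprK (_ : (- f b + f a) / (b - a) = - S); last by rewrite /S; lra.
move=> -[B2 B3] B1 [NB3 NB2] NB1.
by split; rewrite ler_norml; apply/andP; split => //; lra.
Qed.
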